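(* For any De Morgan monoid $\mathbf A$ and any totally ordered odd Sugihara monoid $\mathbf S$, the rigorous extension $\mathbf S[\mathbf A]$ is a De Morgan monoid having $\mathbf A$ as a subalgebra.
   Context: An involutive residuated lattice (IRL) is an algebra $\langle A;\cdot,\wedge,\vee,\neg,e\rangle$ with $\langle A;\cdot,e\rangle$ a commutative monoid, $\langle A;\wedge,\vee\rangle$ a lattice, $\neg\neg x=x$, and $x\cdot y\leqslant z\iff\neg z\cdot y\leqslant\neg x$; $f:=\neg e$. A De Morgan monoid is an IRL with distributive lattice satisfying $x\leqslant x\cdot x$. A Sugihara monoid is a De Morgan monoid with $a\cdot a=a$ for all $a$; it is odd if $f=e$. Rigorous extension: given a De Morgan monoid $\mathbf A$ and a totally ordered odd Sugihara monoid $\mathbf S$ (with $S\cap A=\emptyset$), $\mathbf S[\mathbf A]$ is the algebra $\langle (S\setminus\{e^{\mathbf S}\})\cup A;\cdot',\wedge',\vee',\neg',e^{\mathbf A}\rangle$ where, for $\star\in\{\wedge,\vee,\cdot\}$, $s,p\in S\setminus\{e^{\mathbf S}\}$ and $a,b\in A$: $\neg's=\neg^{\mathbf S}s$, $\neg'a=\neg^{\mathbf A}a$, $s\star'p=s\star^{\mathbf S}p$, $a\star'b=a\star^{\mathbf A}b$, and $a\star's=s\star'a=a$ if $e^{\mathbf S}\star^{\mathbf S}s=e^{\mathbf S}$, while $a\star's=s\star'a=e^{\mathbf S}\star^{\mathbf S}s$ otherwise. (In a totally ordered odd Sugihara monoid, $\neg s$ and $s\star p$ differ from $e^{\mathbf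 S}$ whenever $s,p\neq e^{\mathbf S}$, so these operations are well defined.) *)

(* Defs.v *)
From Stdlib Require Import ClassicalEpsilon.

Set Implicit Arguments.

Record algebra : Type := Algebra {
  carrier :> Type;
  mul : carrier -> carrier -> carrier;
  meet : carrier -> carrier -> carrier;
  join : carrier -> carrier -> carrier;
  neg : carrier -> carrier;
  unit_e : carrier
}.

Arguments mul {_} _ _.
Arguments meet {_} _ _.
Arguments join {_} _ _.
Arguments neg {_} _.
Arguments unit_e _ : clear implicits.

Definition const_f (A : algebra) : A := neg (unit_e A).

Definition le {A : algebra} (x y : A) : Prop := meet x y = x.

Record is_commutative_monoid (T : Type) (op : T -> T -> T) (e : T) : Prop := {
  cm_assoc : forall x y z, op x (op y z) = op (op x y) z;
  cm_comm : forall x y, op x y = op y x;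
  cm_unit : forall x, op e x = x
}.

Record is_lattice (T : Type) (mt jn : T -> T -> T) : Prop := {
  lat_meet_assoc : forall x y z, mt x (mt y z) = mt (mt x y) z;
  lat_join_assoc : forall x y z, jn x (jn y z) = jn (jn x y) z;
  lat_meet_comm : forall x y, mt x y = mt y x;
  lat_join_comm : forall x y, jn x y = jn y x;
  lat_meet_join : forall x y, mt x (jn x y) = x;
  lat_join_meet : forall x y, jn x (mt x y) = x
}.

Record is_IRL (A : algebra) : Prop := {
  irl_monoid : is_commutative_monoid (@mul A) (unit_e A);
  irl_lattice : is_lattice (@meet A) (@join A);
  irl_negK : forall x : A, neg (neg x) = x;
  irl_residuation : forall x y z : A,
    le (mul x y) z <-> le (mul (neg z) y) (neg x)
}.

Record is_De_Morgan_monoid (A : algebra) : Prop := {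
  dmm_IRL : is_IRL A;
  dmm_distributive : forall x y z : A,
    meet x (join y z) = join (meet x y) (meet x z);
  dmm_square_increasing : forall x : A, le x (mul x x)
}.

Record is_Sugihara_monoid (A : algebra) : Prop := {
  sm_DMM : is_De_Morgan_monoid A;
  sm_idempotent : forall a : A, mul a a = a
}.

Definition is_odd (A : algebra) : Prop := const_f A = unit_e A.

Definition is_totally_ordered (A : algebra) : Prop :=
  forall x y : A, le x y \/ le y x.

Record is_totally_ordered_odd_Sugihara_monoid (S : algebra) : Prop := {
  toosm_Sugihara : is_Sugihara_monoid S;
  toosm_odd : is_odd S;
  toosm_total : is_totally_ordered S
}.

Record is_embedding (A B : algebra) (h : A -> B) : Prop := {
  emb_inj : forall x y, h x = h y -> x = y;
  emb_mul : forall x y, h (mul x y) = mul (h x) (h y);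
  emb_meet : forall x y, h (meet x y) = meet (h x) (h y);
  emb_join : forall x y, h (join x y) = join (h x) (h y);
  emb_neg : forall x, h (neg x) = neg (h x);
  emb_unit : h (unit_e A) = unit_e B
}.

Arguments is_embedding {A B} h.

(* The operations of S restrict to S \ {e}. *)
Section Closure.
Variables (S : algebra) (hS : is_totally_ordered_odd_Sugihara_monoid S).

Lemma neg_neq_e (s : S) : s <> unit_e S -> neg s <> unit_e S.
Proof.
  intros hs h. apply hs.
  destruct hS as [[[[_ _ negK _] _ _] _] odd _].
  rewrite <- (negK s), h. exact odd.
Qed.

Lemma mul_neq_e (s p : S) :
  s <> unit_e S -> p <> unit_e S -> mul s p <> unit_e S.
Proof.
  intros hs _ h. apply hs.
  destruct hS as [[[[[assoc comm unit] _ _ _] _ _] idem] _ _].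
  transitivity (mul s (mul s p)).
  - now rewrite h, comm, unit.
  - now rewrite assoc, idem.
Qed.

Lemma meet_neq_e (s p : S) :
  s <> unit_e S -> p <> unit_e S -> meet s p <> unit_e S.
Proof.
  intros hs hp.
  destruct hS as [[[[_ [_ _ mC _ _ _] _ _] _ _] _] _ total].
  destruct (total s p) as [h | h]; unfold le in h.
  - now rewrite h.
  - now rewrite mC, h.
Qed.

Lemma join_neq_e (s p : S) :
  s <> unit_e S -> p <> unit_e S -> join s p <> unit_e S.
Proof.
  intros hs hp.
  destruct hS as [[[[_ [_ _ mC jC _ jm] _ _] _ _] _] _ total].
  destruct (total s p) as [h | h]; unfold le in h.
  - rewrite <- h, mC, jC, jm. exact hp.
  - rewrite <- h, mC, jm. exact hs.
Qed.

End Closure.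

Section RigorousExtension.
Variables (S : algebra) (hS : is_totally_ordered_odd_Sugihara_monoid S).
Variable A : algebra.

(* The sum type realises the disjoint union (S \ {e}) ∪ A, so the proviso that
   S and A be disjoint is automatic. *)
Definition rext_carrier : Type := ({s : S | s <> unit_e S} + A)%type.

Section BinaryOperation.
Variable opS : S -> S -> S.
Hypothesis opS_neq_e : forall s p,
  s <> unit_e S -> p <> unit_e S -> opS s p <> unit_e S.
Variable opA : A -> A -> A.

Definition rext_mixed (a : A) (s : S) : rext_carrier :=
  match excluded_middle_informative (opS (unit_e S) s = unit_e S) with
  | left _ => inr a
  | right h => inl (exist _ (opS (unit_e S) s) h)
  end.

Definition rext_op (x y : rext_carrier) : rext_carrier :=
  match x, y with
  | inl (exist _ s hs), inl (exist _ p hp) =>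
      inl (exist _ (opS s p) (opS_neq_e hs hp))
  | inr a, inr b => inr (opA a b)
  | inr a, inl (exist _ s _) => rext_mixed a s
  | inl (exist _ s _), inr a => rext_mixed a s
  end.

End BinaryOperation.

Definition rext_neg (x : rext_carrier) : rext_carrier :=
  match x with
  | inl (exist _ s hs) => inl (exist _ (neg s) (neg_neq_e hS hs))
  | inr a => inr (neg a)
  end.

Definition rigorous_extension : algebra := {|
  carrier := rext_carrier;
  mul := rext_op (@mul S) (mul_neq_e hS) (@mul A);
  meet := rext_op (@meet S) (meet_neq_e hS) (@meet A);
  join := rext_op (@join S) (join_neq_e hS) (@join A);
  neg := rext_neg;
  unit_e := inr (unit_e A)
|}.

Definition rext_incl : A -> rigorous_extension := fun a => inr a.

End RigorousExtension.

(* Main.v *)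
From Stdlib Require Import ClassicalEpsilon ProofIrrelevance.
Require Import Defs.

Set Implicit Arguments.

(** Collapsing [A] onto the unit of [S] is a homomorphism [rext_proj] from
    [S[A]] to [S], injective off [A].  For the lattice laws we pair it with the
    lattice homomorphism from [S[A]] to [A] with new bounds adjoined, which
    sends [s < e] to the bottom and [s > e] to the top; the pair is injective,
    so [S[A]] is a sublattice of a product of distributive lattices.  For the
    laws involving multiplication, a product in [S] equals [e] only if both
    factors do (idempotence), so every law holds either entirely inside [A], or
    away from [e], where it is inherited from [S]. *)

(** * Consequences of absorption in a lattice *)

Section LatticeFacts.
Variables (T : Type) (mt jn : T -> T -> T) (L : is_lattice mt jn).

Lemma lat_meet_idem (x : T) : mt x x = x.
Proof.
  rewrite <- (lat_join_meet L x x) at 2. apply (lat_meet_join L).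
Qed.

Lemma lat_join_idem (x : T) : jn x x = x.
Proof.
  rewrite <- (lat_meet_join L x x) at 2. apply (lat_join_meet L).
Qed.

Lemma lat_join_eq (x y : T) : mt x y = x <-> jn x y = y.
Proof.
  split; intro h; rewrite <- h.
  - rewrite (lat_meet_comm L), (lat_join_comm L). apply (lat_join_meet L).
  - apply (lat_meet_join L).
Qed.

End LatticeFacts.

(** * Adjoining new bounds to the lattice of [A] *)

Section BoundedExtension.
Variable A : algebra.

(** The bounds are fresh even if [A] is already bounded, so elements of [A] stay apart from the two
    values used for elements of [S]. *)
Inductive bounded : Type := Bot | Mid (_ : A) | Top.

Definition bounded_meet (x y : bounded) : bounded :=
  match x, y with
  | Bot, _ | _, Bot => Bot
  | Top, z | z, Top => z
  | Mid a, Mid b => Mid (meet a b)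
  end.

Definition bounded_join (x y : bounded) : bounded :=
  match x, y with
  | Top, _ | _, Top => Top
  | Bot, z | z, Bot => z
  | Mid a, Mid b => Mid (join a b)
  end.

Lemma bounded_lattice :
  is_lattice (@meet A) (@join A) -> is_lattice bounded_meet bounded_join.
Proof.
  (* Absorption against a new bound can leave [meet a a = a] or [join a a = a] to check in [A]. *)
  intro L; pose proof (lat_meet_idem L); pose proof (lat_join_idem L).
  destruct L.
  split; repeat (intros [| ? |]); simpl; f_equal; auto.
Qed.

Lemma bounded_distributive :
  is_lattice (@meet A) (@join A) ->
  (forall x y z : A, meet x (join y z) = join (meet x y) (meet x z)) ->
  forall x y z, bounded_meet x (bounded_join y z)
                = bounded_join (bounded_meet x y) (bounded_meet x z).
Proof.
  (* For [x = Mid a] and [Top] among [y], [z], distributivity comes down to idempotence or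
     absorption in [A]. *)
  intros L D; pose proof (lat_join_idem L).
  assert (forall a b : A, join (meet a b) a = a)
    by (intros; rewrite (lat_join_comm L); apply (lat_join_meet L)).
  pose proof (lat_join_meet L).
  repeat (intros [| ? |]); simpl; f_equal; auto.
Qed.

End BoundedExtension.

Arguments Bot {A}.
Arguments Mid {A} a.
Arguments Top {A}.

Section RigorousExtension.
Variables (S : algebra) (hS : is_totally_ordered_odd_Sugihara_monoid S).
Variable A : algebra.
Hypothesis hA : is_De_Morgan_monoid A.

Local Notation e := (unit_e S).
Local Notation SA := (rigorous_extension hS A).

Let dS : is_De_Morgan_monoid S := sm_DMM (toosm_Sugihara hS).
Let mS : is_commutative_monoid (@mul S) e := irl_monoid (dmm_IRL dS).
Let lS : is_lattice (@meet S) (@join S) := irl_lattice (dmm_IRL dS).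
Let mA : is_commutative_monoid (@mul A) (unit_e A) := irl_monoid (dmm_IRL hA).
Let lA : is_lattice (@meet A) (@join A) := irl_lattice (dmm_IRL hA).

(** * The projection of [S[A]] onto [S] *)

Definition rext_proj (x : SA) : S :=
  match x with
  | inl s => proj1_sig s
  | inr _ => e
  end.

Lemma rext_proj_eq_e (x : SA) : rext_proj x = e -> exists a : A, x = inr a.
Proof.
  destruct x as [[s hs] | a]; simpl; intro h; [contradiction | eauto].
Qed.

Lemma rext_proj_inj (x y : SA) :
  rext_proj x = rext_proj y -> rext_proj x <> e -> x = y.
Proof.
  destruct x as [[s hs] | a]; [| now simpl].
  destruct y as [[p hp] | b]; simpl; intros h1 h2; [| contradiction].
  subst p. now rewrite (proof_irrelevance _ hs hp).
Qed.

(** In the mixed case the result is either [opS e s] itself or an element of [A], and the latter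
    only when [opS e s = e]. As [rext_mixed] always puts [e] first, commutation with [e] covers the
    other order of arguments. *)
Lemma rext_proj_op (opS : S -> S -> S) opS_neq_e (opA : A -> A -> A) x y :
  opS e e = e -> (forall s, opS s e = opS e s) ->
  rext_proj (rext_op opS opS_neq_e opA x y) = opS (rext_proj x) (rext_proj y).
Proof.
  intros he hc.
  destruct x as [[s hs] | a], y as [[p hp] | b]; simpl; auto;
    unfold rext_mixed; destruct excluded_middle_informative; simpl; auto.
  now rewrite hc.
Qed.

Lemma rext_proj_mul (x y : SA) :
  rext_proj (mul x y) = mul (rext_proj x) (rext_proj y).
Proof.
  apply rext_proj_op; [apply (cm_unit mS) | intro; apply (cm_comm mS)].
Qed.

Lemma rext_proj_meet (x y : SA) :
  rext_proj (meet x y) = meet (rext_proj x) (rext_proj y).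
Proof.
  apply rext_proj_op; [apply (lat_meet_idem lS) | intro; apply (lat_meet_comm lS)].
Qed.

Lemma rext_proj_join (x y : SA) :
  rext_proj (join x y) = join (rext_proj x) (rext_proj y).
Proof.
  apply rext_proj_op; [apply (lat_join_idem lS) | intro; apply (lat_join_comm lS)].
Qed.

Lemma rext_proj_neg (x : SA) : rext_proj (neg x) = neg (rext_proj x).
Proof.
  destruct x as [[s hs] | a]; simpl; auto. symmetry; exact (toosm_odd hS).
Qed.

(** If [sp = e], then [s = s(sp) = (ss)p = sp = e] by idempotence; commutativity gives [p = e]. *)
Lemma mul_eq_e (s p : S) : mul s p = e -> s = e /\ p = e.
Proof.
  pose proof (sm_idempotent (toosm_Sugihara hS)) as idem.
  assert (aux : forall s p : S, mul s p = e -> s = e).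
  { intros u v h.
    rewrite <- (cm_unit mS u), (cm_comm mS), <- h, (cm_assoc mS), idem; auto. }
  intro h; split; [eauto |]. apply (aux p s). now rewrite (cm_comm mS).
Qed.

Lemma neg_eq_e (s : S) : neg s = e -> s = e.
Proof.
  intro h. rewrite <- (irl_negK (dmm_IRL dS) s), h. exact (toosm_odd hS).
Qed.

(** * The lattice laws of [S[A]] *)

Definition rext_level (x : SA) : bounded A :=
  match x with
  | inl s => if excluded_middle_informative (le (proj1_sig s) e) then Bot else Top
  | inr a => Mid a
  end.

(** The projection loses information only on [A], and there the level retains the element. *)
Lemma rext_ext (x y : SA) :
  rext_proj x = rext_proj y -> rext_level x = rext_level y -> x = y.
Proof.
  intros hp hl.
  destruct (excluded_middle_informative (rext_proj x = e)) as [h | h].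
  - destruct (rext_proj_eq_e _ h) as [a ->].
    destruct (rext_proj_eq_e y) as [b ->]; [congruence |].
    simpl in hl; congruence.
  - now apply rext_proj_inj.
Qed.

Lemma le_antisym (s p : S) : le s p -> le p s -> s = p.
Proof.
  unfold le; intros h1 h2. rewrite <- h1, (lat_meet_comm lS). exact h2.
Qed.

Lemma le_trans (s p q : S) : le s p -> le p q -> le s q.
Proof.
  unfold le; intros h1 h2. rewrite <- h1, <- (lat_meet_assoc lS). now rewrite h2.
Qed.

Lemma not_le_le (s p : S) : ~ le s p -> le p s.
Proof. destruct (toosm_total hS s p); tauto. Qed.

Lemma le_meet_join_cases (s p : S) :
  (le s p /\ meet s p = s /\ join s p = p) \/
  (le p s /\ meet s p = p /\ join s p = s).
Proof.
  destruct (toosm_total hS s p) as [h | h]; [left | right];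
    (split; [exact h |]); split.
  - exact h.
  - now apply (lat_join_eq lS).
  - now rewrite (lat_meet_comm lS).
  - rewrite (lat_join_comm lS). now apply (lat_join_eq lS).
Qed.

(** In the chain [S] a meet is one of its arguments, so it lies below [e] exactly when one of them
    does. A mixed meet returns the element of [A] when [s] is above [e], and [s] when it is
    below. *)
Lemma rext_level_meet (x y : SA) :
  rext_level (meet x y) = bounded_meet (rext_level x) (rext_level y).
Proof.
  pose proof le_antisym; pose proof le_trans; pose proof not_le_le.
  destruct x as [[s hs] | a], y as [[p hp] | b]; simpl; auto; unfold rext_mixed;
    [destruct (le_meet_join_cases s p) as [(h1 & h2 & h3) | (h1 & h2 & h3)]
    |destruct (le_meet_join_cases e s) as [(h1 & h2 & h3) | (h1 & h2 & h3)]
    |destruct (le_meet_join_cases e p) as [(h1 & h2 & h3) | (h1 & h2 & h3)]];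
    (* The surviving cases combine incompatible comparisons with [e]; order laws or the exclusion of
       [e] refute them. *)
    repeat (destruct excluded_middle_informative; simpl); auto;
    try rewrite h2 in *; exfalso; eauto 6.
Qed.

Lemma rext_level_join (x y : SA) :
  rext_level (join x y) = bounded_join (rext_level x) (rext_level y).
Proof.
  pose proof le_antisym; pose proof le_trans; pose proof not_le_le.
  destruct x as [[s hs] | a], y as [[p hp] | b]; simpl; auto; unfold rext_mixed;
    [destruct (le_meet_join_cases s p) as [(h1 & h2 & h3) | (h1 & h2 & h3)]
    |destruct (le_meet_join_cases e s) as [(h1 & h2 & h3) | (h1 & h2 & h3)]
    |destruct (le_meet_join_cases e p) as [(h1 & h2 & h3) | (h1 & h2 & h3)]];
    repeat (destruct excluded_middle_informative; simpl); auto;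
    try rewrite h3 in *; exfalso; eauto 6.
Qed.

Lemma rext_lattice : is_lattice (@meet SA) (@join SA).
Proof.
  pose proof (bounded_lattice _ lA) as lB.
  split; intros; apply rext_ext;
    repeat rewrite ?rext_proj_meet, ?rext_proj_join,
      ?rext_level_meet, ?rext_level_join;
    solve [apply lS | apply lB].
Qed.

Lemma rext_distributive (x y z : SA) :
  meet x (join y z) = join (meet x y) (meet x z).
Proof.
  apply rext_ext;
    repeat rewrite ?rext_proj_meet, ?rext_proj_join,
      ?rext_level_meet, ?rext_level_join.
  - apply (dmm_distributive dS).
  - apply (bounded_distributive lA), (dmm_distributive hA).
Qed.

(** * The monoid laws *)

Lemma rext_monoid : is_commutative_monoid (@mul SA) (unit_e SA).
Proof.
  split.
  - intros x y z.
    destruct (excluded_middle_informative (rext_proj (mul x (mul y z)) = e))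
      as [h | h].
    + rewrite !rext_proj_mul in h.
      destruct (mul_eq_e _ _ h) as [hx h']; destruct (mul_eq_e _ _ h') as [hy hz].
      apply rext_proj_eq_e in hx as [a ->], hy as [b ->], hz as [c ->].
      simpl; f_equal; apply (cm_assoc mA).
    + apply rext_proj_inj; [| exact h].
      rewrite !rext_proj_mul; apply (cm_assoc mS).
  - intros x y.
    destruct (excluded_middle_informative (rext_proj (mul x y) = e)) as [h | h].
    + rewrite rext_proj_mul in h. destruct (mul_eq_e _ _ h) as [hx hy].
      apply rext_proj_eq_e in hx as [a ->], hy as [b ->].
      simpl; f_equal; apply (cm_comm mA).
    + apply rext_proj_inj; [| exact h].
      rewrite !rext_proj_mul; apply (cm_comm mS).
  - intro x.
    assert (hp : rext_proj (mul (unit_e SA) x) = rext_proj x)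
      by (rewrite rext_proj_mul; apply (cm_unit mS)).
    destruct (excluded_middle_informative (rext_proj x = e)) as [h | h].
    + apply rext_proj_eq_e in h as [a ->]. simpl; f_equal; apply (cm_unit mA).
    + apply rext_proj_inj; [| rewrite hp]; assumption.
Qed.

(** * Order, residuation and negation *)

Lemma rext_le_incl (a b : A) : le (inr a : SA) (inr b) <-> le a b.
Proof. unfold le; simpl; split; congruence. Qed.

(** The projection preserves meets and is injective off [A]. If [x] is in [A], then [y] is not, and
    [e] lying below [y] is precisely the condition under which the mixed meet returns [x]. *)
Lemma rext_le_proj (x y : SA) :
  ~ (rext_proj x = e /\ rext_proj y = e) ->
  le x y <-> le (rext_proj x) (rext_proj y).
Proof.
  intro hn; unfold le; split; intro h.
  - rewrite <- rext_proj_meet. now rewrite h.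
  - rewrite <- rext_proj_meet in h.
    destruct (excluded_middle_informative (rext_proj x = e)) as [hx | hx].
    + destruct (rext_proj_eq_e _ hx) as [a ->].
      destruct y as [[p hp] | b]; [| now destruct hn].
      simpl in *; unfold rext_mixed in *.
      destruct excluded_middle_informative; simpl in *; [reflexivity | contradiction].
    + apply rext_proj_inj; congruence.
Qed.

Lemma rext_residuation (x y z : SA) :
  le (mul x y) z <-> le (mul (neg z) y) (neg x).
Proof.
  destruct (excluded_middle_informative
              (rext_proj x = e /\ rext_proj y = e /\ rext_proj z = e))
    as [(hx & hy & hz) | hn].
  - apply rext_proj_eq_e in hx as [a ->], hy as [b ->], hz as [c ->].
    simpl; rewrite !rext_le_incl. apply (irl_residuation (dmm_IRL hA)).
  (* Neither inequality has both sides in [A]: by [mul_eq_e] and [neg_eq_e] that would force [x],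
     [y] and [z] all into [A]. *)
  - rewrite !rext_le_proj; rewrite ?rext_proj_mul, ?rext_proj_neg.
    + apply (irl_residuation (dmm_IRL dS)).
    + intros [h1 h2]. apply mul_eq_e in h1 as [h1 h3].
      apply neg_eq_e in h1, h2. tauto.
    + intros [h1 h2]. apply mul_eq_e in h1. tauto.
Qed.

Lemma rext_negK (x : SA) : neg (neg x) = x.
Proof.
  destruct (excluded_middle_informative (rext_proj x = e)) as [h | h].
  - apply rext_proj_eq_e in h as [a ->].
    simpl; f_equal; apply (irl_negK (dmm_IRL hA)).
  (* The swap puts the side condition of [rext_proj_inj] on [x] instead of its double negation. *)
  - symmetry; apply rext_proj_inj; [| exact h].
    rewrite !rext_proj_neg; symmetry; apply (irl_negK (dmm_IRL dS)).
Qed.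

Lemma rext_square_increasing (x : SA) : le x (mul x x).
Proof.
  destruct (excluded_middle_informative (rext_proj x = e)) as [h | h].
  - apply rext_proj_eq_e in h as [a ->].
    simpl; apply rext_le_incl, (dmm_square_increasing hA).
  - apply rext_le_proj; [tauto |].
    rewrite rext_proj_mul; apply (dmm_square_increasing dS).
Qed.

Lemma rext_De_Morgan_monoid : is_De_Morgan_monoid SA.
Proof.
  split; [split | |].
  - exact rext_monoid.
  - exact rext_lattice.
  - exact rext_negK.
  - exact rext_residuation.
  - exact rext_distributive.
  - exact rext_square_increasing.
Qed.

(** On [inr] elements every operation computes to that of [A]. *)
Lemma rext_incl_embedding : is_embedding (rext_incl hS A).
Proof. split; try reflexivity. unfold rext_incl; congruence. Qed.

End RigorousExtension.

Theorem theorem7p18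
  (A : algebra) (hA : is_De_Morgan_monoid A)
  (S : algebra) (hS : is_totally_ordered_odd_Sugihara_monoid S) :
  is_De_Morgan_monoid (rigorous_extension hS A) /\
  is_embedding (rext_incl hS A).
Proof.
  split; [now apply rext_De_Morgan_monoid | apply rext_incl_embedding].
Qed.
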